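(* There exists a constant $c>0$ such that for any integers $1\le k\le n$ and any $\delta\in(0,1/2]$, $$\sup_{\lambda\in\mathbb R}\mathsf Q_{1-\delta}\Big(\Gamma_{\operatorname{span}\{e_1,\dots,e_k\}}\big(\varepsilon;\lambda(e_1+\cdots+e_k)\big)\Big)\ge c\Big(k+\log\frac1\delta\Big),$$ where for each $\lambda$ the quantile is under $\varepsilon\sim p_{\lambda(e_1+\cdots+e_k)}$.
   Context: $e_1,\dots,e_n$ is the canonical basis of $\mathbb R^n$; $\sigma(t)=1/(1+e^{-t})$. For $v\in\mathbb R^n$ and $\varepsilon\in\{-1,1\}^n$, $p_v(\varepsilon)=\prod_{i=1}^n\sigma(\varepsilon_iv_i)$, a probability mass function on $\{-1,1\}^n$. For a subspace $W\subset\mathbb R^n$, $\Gamma_W(\varepsilon;v)=\sup_{w\in W}\log\frac{p_w(\varepsilon)}{p_v(\varepsilon)}$. For a real random variable $Z$, $\mathsf Q_{1-\delta}(Z)=\inf\{z\in\mathbb R:\mathbf P(Z\le z)\ge1-\delta\}$. *)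

(* Defs.v *)
From HB Require Import structures.
From mathcomp Require Import all_boot all_order all_algebra.
From mathcomp Require Import all_classical all_reals all_analysis.

Set Implicit Arguments.
Unset Strict Implicit.
Unset Printing Implicit Defensive.

Import Order.TTheory GRing.Theory Num.Theory.

Local Open Scope classical_set_scope.
Local Open Scope ring_scope.

Definition sigma {R : realType} (t : R) : R := (1 + expR (- t))^-1.

(* The cube {-1,1}^n. The boolean e i encodes the sign (-1) ^+ e i, so [true]
   stands for -1 and [false] for 1. *)
Definition cube (n : nat) := {ffun 'I_n -> bool}.

Definition cube_pmf {R : realType} {n : nat} (v : 'rV[R]_n) (e : cube n) : R :=
  \prod_(i < n) sigma ((-1) ^+ e i * v 0 i).

(* A supremum in R: the set is nonempty and bounded above, see [Gamma_has_sup]. *)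
Definition Gamma {R : realType} {n : nat} (W : {vspace 'rV[R]_n})
    (v : 'rV[R]_n) (e : cube n) : R :=
  sup [set ln (cube_pmf w e / cube_pmf v e) | w in [set w : 'rV[R]_n | w \in W]].

Definition Prob {R : realType} {T : finType} (p : T -> R) (A : set T) : R :=
  \sum_(x : T | x \in A) p x.

(* The quantile Q_q(Z) of a real random variable Z on the finite space T with
   mass function p, as an extended real: no junk value is attached to the
   infimum of an empty or unbounded set. *)
Definition quantile {R : realType} {T : finType} (p : T -> R) (q : R)
    (Z : T -> R) : \bar R :=
  ereal_inf [set z%:E | z in [set z : R | q <= Prob p [set x | Z x <= z]]].

(* With 0-based ordinals, e_1, ..., e_k are the [delta_mx 0 i] with i < k. *)
Definition span_first (R : realType) (n k : nat) : {vspace 'rV[R]_n} :=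
  span [seq delta_mx 0 i | i : 'I_n <- enum 'I_n & (i < k)%N].

Definition sum_first (R : realType) (n k : nat) : 'rV[R]_n :=
  \sum_(i < n | (i < k)%N) delta_mx 0 i.

Lemma sigma_gt0 (R : realType) (t : R) : 0 < sigma t.
Proof. by rewrite invr_gt0 addr_gt0 // expR_gt0. Qed.

Lemma sigma_le1 (R : realType) (t : R) : sigma t <= 1.
Proof.
by rewrite invf_le1 ?addr_gt0 ?expR_gt0 // lerDl ltW // expR_gt0.
Qed.

Lemma sigma_add_opp (R : realType) (t : R) : sigma (- t) + sigma t = 1.
Proof.
have h : expR t != 0 by rewrite gt_eqF // expR_gt0.
have h1 : 1 + expR t != 0 by rewrite gt_eqF // addr_gt0 // expR_gt0.
have h2 : expR t + 1 != 0 by rewrite addrC.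
rewrite /sigma opprK expRN.
have -> : 1 + (expR t)^-1 = (expR t + 1) / expR t by rewrite mulrDl divff // mul1r.
by rewrite invf_div addrC [1 + _]addrC -[X in _ + X]mul1r -mulrDl divff.
Qed.

Lemma cube_pmf_gt0 (R : realType) (n : nat) (v : 'rV[R]_n) (e : cube n) :
  0 < cube_pmf v e.
Proof. by apply: prodr_gt0 => i _; exact: sigma_gt0. Qed.

Lemma cube_pmf_le1 (R : realType) (n : nat) (v : 'rV[R]_n) (e : cube n) :
  cube_pmf v e <= 1.
Proof.
by apply: prodr_ile1 => i; rewrite ltW ?sigma_gt0 //= sigma_le1.
Qed.

Lemma sum_cube_pmf (R : realType) (n : nat) (v : 'rV[R]_n) :
  \sum_(e : cube n) cube_pmf v e = 1.
Proof.
rewrite /cube_pmf -(bigA_distr_bigA (fun i (b : bool) => sigma ((-1) ^+ b * v 0 i))).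
by apply: big1 => i _; rewrite big_bool /= expr1 expr0 mulN1r mul1r sigma_add_opp.
Qed.

Lemma Gamma_has_sup (R : realType) (n : nat) (W : {vspace 'rV[R]_n})
    (v : 'rV[R]_n) (e : cube n) :
  has_sup [set ln (cube_pmf w e / cube_pmf v e) | w in [set w : 'rV[R]_n | w \in W]].
Proof.
split; first by exists (ln (cube_pmf 0 e / cube_pmf v e)), 0 => //=; exact: mem0v.
exists (ln (cube_pmf v e)^-1) => _ [w _ <-].
rewrite ler_ln ?posrE ?divr_gt0 ?invr_gt0 ?cube_pmf_gt0 //.
by rewrite ler_piMl ?cube_pmf_le1 // ltW // invr_gt0 cube_pmf_gt0.
Qed.

(* Main.v *)
Require Import Defs.
From HB Require Import structures.
From mathcomp Require Import all_boot all_order all_algebra.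
From mathcomp Require Import all_classical all_reals all_analysis.
From mathcomp Require Import ring lra.

Set Implicit Arguments.
Unset Strict Implicit.
Unset Printing Implicit Defensive.

Import Order.TTheory GRing.Theory Num.Theory.

Local Open Scope classical_set_scope.
Local Open Scope ring_scope.

(* Let v = lambda (e_1 + ... + e_k).  For each sign vector, choosing w in the
   span with the same signs and large entries drives p_w towards 1 on the first
   k coordinates, so Gamma is essentially - log of the probability of the first
   k signs under p_v.  At lambda = 0 this is k log 2 deterministically.  If
   lambda is chosen so that the first k signs are all -1 with probability
   sqrt(delta) > delta, then the (1 - delta)-quantile is at least of order
   log (1/delta). *)

(** Lets a parameter be prescribed through the value of [sigma] at it. *)
Lemma sigma_logit (R : realType) (a : R) :
  0 < a -> a < 1 -> sigma (ln (a / (1 - a))) = a.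
Proof.
move=> a0 a1; have a1' : 0 < 1 - a by rewrite subr_gt0.
rewrite /sigma expRN lnK ?posrE ?divr_gt0 // invf_div.
have -> : 1 + (1 - a) / a = a^-1 by field; rewrite gt_eqF.
by rewrite invrK.
Qed.

(** If some z < m were admissible in the infimum, the events Z <= z and [A] would be disjoint with
    total mass above q + (1 - q) = 1. *)
Lemma ler_quantile (R : realType) (T : finType) (p : T -> R) (q m : R)
    (Z : T -> R) (A : set T) :
  (forall x, 0 <= p x) -> \sum_x p x = 1 -> 1 - q < Prob p A ->
  (forall x, A x -> m <= Z x) -> (m%:E <= quantile p q Z)%E.
Proof.
move=> p0 p1 qA mZ; apply: le_ereal_inf_tmp => _ [z /= qz <-]; rewrite lee_fin.
rewrite leNgt; apply/negP => zm.
suff : Prob p [set x | Z x <= z] + Prob p A <= 1 by lra.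
rewrite -p1 addrC (bigID (mem A)) lerD2l /Prob big_mkcond [leRHS]big_mkcond.
apply: ler_sum => x _; case: ifPn => [|_]; last by case: ifP.
rewrite inE /= => Zxz; case: ifPn => //; rewrite negbK inE => /mZ mZx.
by have := le_lt_trans (le_trans mZx Zxz) zm; rewrite ltxx.
Qed.

Lemma scale_sum_firstE (R : realType) (n k : nat) (lambda : R) (i : 'I_n) :
  (lambda *: sum_first R n k) 0 i = if (i < k)%N then lambda else 0.
Proof.
rewrite mxE summxE big_mkcond (bigD1 i) //= big1 ?addr0 => [|j ji].
  by rewrite mxE !eqxx; case: ifP; rewrite ?mulr1 ?mulr0.
by rewrite mxE eqxx eq_sym (negbTE ji) if_same.
Qed.

Lemma mem_span_first (R : realType) (n k : nat) (w : 'rV[R]_n) :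
  (forall i : 'I_n, (k <= i)%N -> w 0 i = 0) -> w \in span_first R n k.
Proof.
move=> w0; rewrite [w]row_sum_delta; apply: memv_suml => i _.
case: (ltnP i k) => [ik|/w0 ->]; last by rewrite scale0r mem0v.
apply/memvZ/memv_span/mapP; exists i => //.
by rewrite mem_filter ik mem_enum.
Qed.

Lemma prodr_ord_lt (R : comPzRingType) (n k : nat) (x : R) :
  (k <= n)%N -> \prod_(i < n) (if (i < k)%N then x else 1) = x ^+ k.
Proof.
by move=> kn; rewrite -big_mkcond (big_ord_narrow kn) prodr_const card_ord.
Qed.

(** The competitor [w] has entries [t] times the signs of [e] on the first k coordinates. Each of
    these contributes [sigma t / sigma mu]; on the others both vectors vanish and the factors
    cancel. A finite [t] avoids passing to a limit. *)
Lemma Gamma_span_first_ge (R : realType) (n k : nat) (lambda mu t : R)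
    (e : cube n) :
  (k <= n)%N ->
  (forall i : 'I_n, (i < k)%N -> (-1) ^+ e i * lambda = mu) ->
  k%:R * ln (sigma t / sigma mu) <=
    Gamma (span_first R n k) (lambda *: sum_first R n k) e.
Proof.
move=> kn emu.
pose w : 'rV[R]_n := \row_i (if (i < k)%N then (-1) ^+ e i * t else 0).
apply: ub_le_sup.
  by case: (Gamma_has_sup (span_first R n k) (lambda *: sum_first R n k) e).
exists w; first by apply: mem_span_first => i ki; rewrite mxE ltnNge ki.
rewrite mulr_natl -lnXn ?divr_gt0 ?sigma_gt0 //; congr ln.
rewrite -(prodr_ord_lt _ kn) /cube_pmf -prodf_div; apply: eq_bigr => i _.
rewrite scale_sum_firstE mxE; case: ifPn => [ik|_].
  by rewrite mulrA -signr_addb addbb mul1r emu.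
by rewrite mulr0 divff // gt_eqF // sigma_gt0.
Qed.

(** The event is a product set, so its mass factors over coordinates. Since [true] encodes -1, each
    of the first k gives [sigma (- lambda)]; the others are unconstrained and give 1. *)
Lemma Prob_first_signs (R : realType) (n k : nat) (lambda : R) :
  (k <= n)%N ->
  Prob (cube_pmf (lambda *: sum_first R n k))
    [set e : cube n | forall i : 'I_n, (i < k)%N -> e i] = sigma (- lambda) ^+ k.
Proof.
move=> kn; pose Q (i : 'I_n) : pred bool := [pred b | (i < k)%N ==> b].
rewrite /Prob (eq_bigl (mem (family Q))) => [|e /=]; last first.
  apply/idP/familyP => [|eQ]; first by rewrite inE => eT i; apply/implyP/eT.
  by rewrite inE => i; apply/implyP/eQ.
rewrite /cube_pmf -(bigA_distr_big_dep Q
  (fun i b => sigma ((-1) ^+ b * (lambda *: sum_first R n k) 0 i))).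
rewrite -(prodr_ord_lt _ kn); apply: eq_bigr => i _.
rewrite scale_sum_firstE big_mkcond big_bool {}/Q /= implybT implybF.
case: ifP => _ /=; first by rewrite addr0 expr1 mulN1r.
by rewrite !mulr0 -[X in _ + sigma X]oppr0 addrC sigma_add_opp.
Qed.

Lemma quantile_Gamma_zero_ge (R : realType) (n k : nat) (delta : R) :
  (k <= n)%N -> delta < 1 ->
  ((k%:R / 3)%:E <= quantile (cube_pmf (0 *: sum_first R n k)) (1 - delta)
     (fun e : cube n => Gamma (span_first R n k) (0 *: sum_first R n k) e))%E.
Proof.
move=> kn d1.
apply: (@ler_quantile _ _ _ _ _ _ [set: cube n]) => [e|||e _].
- exact/ltW/cube_pmf_gt0.
- exact: sum_cube_pmf.
- rewrite subKr /Prob (eq_bigl xpredT) ?sum_cube_pmf // => e.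
  exact/mem_set.
(* Against [sigma 0] = 1/2, the value 3/4 gives the ratio 3/2, and ln (3/2) = - ln (1 - 1/3) >=
   1/3. *)
have sig34 : sigma (ln (3 / 4 / (1 - 3 / 4))) = 3 / 4 :> R.
  by rewrite sigma_logit //; lra.
apply: le_trans (@Gamma_span_first_ge _ _ _ 0 0 (ln (3 / 4 / (1 - 3 / 4))) e kn _).
  rewrite ler_wpM2l // sig34 /sigma oppr0 expR0 invrK.
  have -> : 3 / 4 * (1 + 1) = (1 + - 3^-1)^-1 :> R by field.
  by rewrite lnV ?posrE; [rewrite lerNr le_ln1Dx|]; lra.
by move=> i _; rewrite mulr0.
Qed.

Lemma quantile_Gamma_tail_ge (R : realType) (n k : nat) (delta : R) :
  (0 < k)%N -> (k <= n)%N -> 0 < delta -> delta < 1 ->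
  exists lambda : R, ((ln delta^-1 / 4)%:E <=
    quantile (cube_pmf (lambda *: sum_first R n k)) (1 - delta)
      (fun e : cube n =>
         Gamma (span_first R n k) (lambda *: sum_first R n k) e))%E.
Proof.
move=> k0 kn d0 d1; have kR0 : 0 < k%:R :> R by rewrite ltr0n.
have lnd : ln delta < 0 by rewrite ln_lt0 // d0.
(* [- lambda] and the entries of w are chosen so that the first k signs have
   probability delta^(1/2) under p_v and delta^(1/4) under p_w. *)
pose root (m : R) := expR (ln delta / (m * k%:R)).
have root1 m : 0 < m -> root m < 1.
  by move=> m0; rewrite expR_lt1 pmulr_llt0 // invr_gt0 mulr_gt0.
pose logit (x : R) := ln (x / (1 - x)).
exists (- logit (root 2)).
apply: (@ler_quantile _ _ _ _ _ _
  [set e : cube n | forall i : 'I_n, (i < k)%N -> e i]) => [e|||e /= eT].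
- exact/ltW/cube_pmf_gt0.
- exact: sum_cube_pmf.
- rewrite Prob_first_signs // opprK sigma_logit ?expR_gt0 ?root1 // subKr.
  rewrite -expRM_natl -[ltLHS]lnK ?posrE // ltr_expR.
  have -> : k%:R * (ln delta / (2 * k%:R)) = ln delta / 2.
    by field; rewrite gt_eqF.
  lra.
(* The ratio of the two roots is delta^(-1/(4k)), and k times its logarithm is [ln delta^-1 / 4]. *)
apply: le_trans
  (@Gamma_span_first_ge _ _ _ _ (logit (root 2)) (logit (root 4)) e kn _).
  rewrite !sigma_logit ?expR_gt0 ?root1 // -expRN -expRD expRK lnV ?posrE //.
  by rewrite le_eqVlt; apply/orP; left; apply/eqP; field; rewrite gt_eqF.
by move=> i /eT ->; rewrite expr1 mulN1r opprK.
Qed.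

Theorem proposition2p3 (R : realType) :
  exists2 c : R, 0 < c &
    forall (n k : nat) (delta : R),
      (1 <= k)%N -> (k <= n)%N -> 0 < delta -> delta <= 2^-1 ->
      ((c * (k%:R + ln (delta^-1)))%:E <=
        ereal_sup [set
          quantile (cube_pmf (lambda *: sum_first R n k)) (1 - delta)
            (fun e : cube n =>
               Gamma (span_first R n k) (lambda *: sum_first R n k) e)
          | lambda in [set: R]])%E.
Proof.
(* The larger of k and log (1/delta) is at least half their sum; the weaker factor 1/4 of the two
   bounds then gives 1/8. *)
exists 8^-1 => [|n k delta k0 kn d0 d2]; first by rewrite invr_gt0.
have d1 : delta < 1 by lra.
have [lambda tail] := quantile_Gamma_tail_ge k0 kn d0 d1.
have zero := quantile_Gamma_zero_ge kn d1.
have k0R : 0 <= k%:R :> R by [].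
apply: le_ereal_sup_tmp.
have [Lk|kL] := leP (ln delta^-1) k%:R.
  eexists; first by exists 0.
  by apply: le_trans zero; rewrite lee_fin; lra.
eexists; first by exists lambda.
by apply: le_trans tail; rewrite lee_fin; lra.
Qed.
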